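(* For every integer $n\ge 1$, the following identities hold. (i) $$\sum_{\sigma\in B_n^{*}} \left(-\frac{1}{q}\right)^{\lfloor \mathrm{fwex}(\sigma)/2\rfloor} t^{\mathrm{neg}(\sigma)}q^{\mathrm{cro}_B(\sigma)}=\left(-\frac{1}{q}\right)^{\lfloor\frac{n}{2}\rfloor}Q_n(t,q).$$ (ii) $$\sum_{\sigma\in D_n^{*}} \left(-\frac{1}{q}\right)^{\lfloor \mathrm{fwex}(\sigma)/2\rfloor} t^{\mathrm{neg}(\sigma)}q^{\mathrm{cro}_B(\sigma)}=\begin{cases}\left(-\frac{1}{q}\right)^{\frac n2}Q_{n}(t,q) & \text{if } n \text{ is even},\\ 0 & \text{if } n \text{ is odd}.\end{cases}$$
   Context: Let $[n]=\{1,\dots,n\}$. A signed permutation of $[n]$ is a bijection $\sigma$ of $\{-n,\dots,-1,1,\dots,n\}$ onto itself with $\sigma(-i)=-\sigma(i)$ for all $i$; it is written $\sigma=\sigma_1\sigma_2\cdots\sigma_n$ with $\sigma_i=\sigma(i)$. $B_n$ is the set of signed permutations of $[n]$, and $D_n\subset B_n$ is the subset of those with an even number of negative entries among $\sigma_1,\dots,\sigma_n$. $B_n^*$ (resp. $D_n^*$) is the subset of $B_n$ (resp. $D_n$) of elements without fixed points, i.e. with $\sigma_i\ne i$ for all $i\in[n]$. For $\sigma\in B_n$: $\mathrm{neg}(\sigma)=\#\{i\in[n]:\sigma_i<0\}$, $\mathrm{wex}(\sigma)=\#\{i\in[n]:\sigma_i\ge i\}$, and $\mathrm{fwex}(\sigma)=2\,\mathrm{wex}(\sigma)+\mathrm{neg}(\sigma)$.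 A crossing of $\sigma$ is a pair $(i,j)$ with $i,j\in[n]$ such that $i<j\le\sigma_i<\sigma_j$, or $-i<j\le-\sigma_i<\sigma_j$, or $i>j>\sigma_i>\sigma_j$; $\mathrm{cro}_B(\sigma)$ is the number of crossings of $\sigma$. Let $D$ be the $q$-derivative acting on polynomials in $t$, $(Df)(t)=\frac{f(qt)-f(t)}{(q-1)t}$ (so $D(t^m)=[m]_q t^{m-1}$ with $[m]_q=1+q+\cdots+q^{m-1}$, $[0]_q=0$), and let $U$ be multiplication by $t$. Define $Q_n(t,q)=(D+UDU)^n\,1$ for $n\ge 0$ (products of operators are compositions, the rightmost applied first). *)

(* Defs.v *)
From HB Require Import structures.
From mathcomp Require Import all_boot all_order all_algebra all_fingroup.

Set Implicit Arguments.
Unset Strict Implicit.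
Unset Printing Implicit Defensive.

Import Order.TTheory GRing.Theory Num.Theory.

Local Open Scope ring_scope.

(* The set {-n, ..., -1, 1, ..., n}: (i, false) stands for i + 1 and (i, true)
   for -(i + 1); the shift by one is because 'I_n starts at 0. *)
Definition letter (n : nat) := ('I_n * bool)%type.

Definition letter_val (n : nat) (x : letter n) : int :=
  if x.2 then - (x.1.+1%:Z) else x.1.+1%:Z.

Definition letter_opp (n : nat) (x : letter n) : letter n := (x.1, ~~ x.2).

Lemma letter_val_inj (n : nat) : injective (@letter_val n).
Proof.
by move=> [i [|]] [j [|]] //=; rewrite /letter_val /=;
  [move/oppr_inj | ..] => // -[/val_inj ->].
Qed.

Lemma letter_valN (n : nat) (x : letter n) :
  letter_val (letter_opp x) = - letter_val x.
Proof. by case: x => i [|]; rewrite /letter_val /= ?opprK. Qed.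

Lemma letter_valP (n : nat) (z : int) :
  reflect (exists x : letter n, letter_val x = z) (0 < `|z| <= n)%N.
Proof.
apply: (iffP andP) => [[z_gt0 z_le] | [[i b] <-]]; last first.
  by case: b; rewrite /letter_val /= ?abszN /= ltn_ord.
case: z z_gt0 z_le => [[//|k]|k] /= _ lt_kn.
  by exists (Ordinal lt_kn, false).
by exists (Ordinal lt_kn, true); rewrite /letter_val /= -NegzE.
Qed.

Definition Bset (n : nat) : {set {perm letter n}} :=
  [set s : {perm letter n} | [forall x, s (letter_opp x) == letter_opp (s x)]].

(* The position i + 1 in [n] represented by i : 'I_n, as an integer. *)
Definition pos (n : nat) (i : 'I_n) : int := i.+1%:Z.

(* The entry sigma_(i + 1) of the one-line notation. *)
Definition entry (n : nat) (s : {perm letter n}) (i : 'I_n) : int :=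
  letter_val (s (i, false)).

Definition neg (n : nat) (s : {perm letter n}) : nat :=
  #|[set i : 'I_n | entry s i < 0]|.

Definition wex (n : nat) (s : {perm letter n}) : nat :=
  #|[set i : 'I_n | pos i <= entry s i]|.

Definition fwex (n : nat) (s : {perm letter n}) : nat := (2 * wex s + neg s)%N.

Definition crossing (n : nat) (s : {perm letter n}) (i j : 'I_n) : bool :=
  [|| [&& pos i < pos j, pos j <= entry s i & entry s i < entry s j],
      [&& - pos i < pos j, pos j <= - entry s i & - entry s i < entry s j]
    | [&& pos i > pos j, pos j > entry s i & entry s i > entry s j]].

Definition cro_B (n : nat) (s : {perm letter n}) : nat :=
  #|[set p : 'I_n * 'I_n | crossing s p.1 p.2]|.

Definition Dset (n : nat) : {set {perm letter n}} :=
  [set s in Bset n | ~~ odd (neg s)].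

Definition fixfree (n : nat) (s : {perm letter n}) : bool :=
  [forall i : 'I_n, entry s i != pos i].

Definition Bstar (n : nat) : {set {perm letter n}} :=
  [set s in Bset n | fixfree s].

Definition Dstar (n : nat) : {set {perm letter n}} :=
  [set s in Dset n | fixfree s].

Section Operators.
Variable F : fieldType.
Implicit Types (q : F) (f : {poly F}).

Definition qint q (m : nat) : F := \sum_(k < m) q ^+ k.

(* Linear extension of t^m |-> [m]_q t^(m-1).  This makes sense also for q = 1;
   for q != 1 it is the quotient (f(qt) - f(t)) / ((q - 1) t), see qderivE. *)
Definition qderiv q f : {poly F} :=
  \poly_(i < (size f).-1) (qint q i.+1 * f`_i.+1).

Definition opU f : {poly F} := 'X * f.

Definition Qpoly q (n : nat) : {poly F} :=
  iter n (fun f => qderiv q f + opU (qderiv q (opU f))) 1.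

Lemma coef_qderiv q f i : (qderiv q f)`_i = qint q i.+1 * f`_i.+1.
Proof.
rewrite coef_poly; case: ltnP => // le_fi.
by rewrite [f`_ _]nth_default ?mulr0 //; case: (size f) le_fi.
Qed.

Lemma qderivXn q (m : nat) : qderiv q 'X^m = qint q m *: 'X^(m.-1).
Proof.
apply/polyP=> i; rewrite coef_qderiv coefZ !coefXn.
case: m => [|m] /=; last by rewrite eqSS; case: eqP => [->|]; rewrite ?mulr0.
by rewrite /qint big_ord0 mul0r mulr0.
Qed.

Lemma qderiv_is_linear q : linear (qderiv q).
Proof.
move=> a f g; apply/polyP=> i.
by rewrite !(coef_qderiv, coefD, coefZ) mulrDr mulrCA.
Qed.

Lemma qderiv_mul q f :
  qderiv q f * ((q - 1) *: 'X) = f \Po (q *: 'X) - f.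
Proof.
have comp_coef i : (f \Po (q *: 'X))`_i = q ^+ i * f`_i.
  rewrite comp_polyE coef_sum.
  under eq_bigr => j _ do rewrite exprZn !coefZ coefXn.
  have [lt_if | le_fi] := ltnP i (size f).
    rewrite (bigD1 (Ordinal lt_if)) //= eqxx mulr1 mulrC big1 ?addr0 // => j.
    by rewrite -val_eqE eq_sym /= => /negPf->; rewrite !mulr0.
  rewrite [f`_i]nth_default // mulr0 big1 // => j _.
  by rewrite gtn_eqF ?mulr0 // (leq_trans (ltn_ord j)).
apply/polyP=> i; rewrite -scalerAr coefZ coefMX coefB comp_coef.
case: i => [|i] /=; first by rewrite mulr0 expr0 mul1r subrr.
by rewrite coef_qderiv mulrA /qint -subrX1 mulrBl mul1r.
Qed.

Lemma qderivE q f : q != 1 ->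
  qderiv q f = (f \Po (q *: 'X) - f) %/ ((q - 1) *: 'X).
Proof.
move=> q_neq1; rewrite -qderiv_mul mulpK //.
by rewrite scaler_eq0 subr_eq0 (negPf q_neq1) polyX_eq0.
Qed.

End Operators.

(* Main.v *)
Require Import Defs.
From HB Require Import structures.
From mathcomp Require Import all_boot all_order all_algebra all_fingroup.
From mathcomp Require Import zify ring.

(** Draw a signed permutation s as n arcs, the arc from the position i to the
    signed value s_i, for i in [n], and uncover the arcs from right to left.
    Call R_k the set of possible arcs whose source and target both lie in
    {k, ..., n}, with positive target.  Once the arcs of s in R_k are known, the
    points to the right of the gap before k contain as many sources without a
    known target as targets without a known source; call their common number h.
    Moving the gap past one more point k settles two questions: where the arc
    into k comes from, and where the arc out of k goes to.
    - A source b > k is sent to k by choosing it among the h free sources; the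
      crossings that this choice creates are those with the free sources
      smaller than b, so the choices contribute [h]_q in total.
    - Dually, the arc out of k ends at one of the free targets a, and creates a
      crossing with each smaller free target.  If the source of k is still
      unknown, k itself is a free target smaller than a, which accounts for the
      crossings i < j = s_i < s_j; the factor is then q [h]_q, and otherwise
      [h]_q.  Such an arc is a weak excedance, hence an extra factor y.
    - Both questions can also stay open, and h then grows by one.
    At the end the remaining sources take the remaining targets with a negative
    sign, so neg s = h, and the crossings among these arcs are counted by the
    q-factorial [h]_q!.  Hence (lemma [sum_Bset_path_sum]) the sum over the
    fixed-point-free s of y^wex q^cro phi(neg s), for any function phi, is a
    weighted count of Motzkin paths: up steps have weight 1, level steps at
    height h have weight (1 + yq) [h]_q, down steps from height h have weight
    y [h]_q^2, and the end at height h has weight [h]_q! phi(h).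

    For y = - 1/q the level steps cancel, so the parity of the final height is
    that of n; this is why the sum over D_n vanishes for odd n and agrees with
    the sum over B_n for even n.  The remaining powers of y always multiply to
    y^floor(n/2).  Finally D + UDU sends t^h to [h]_q t^(h-1) + [h+1]_q t^(h+1),
    and rescaling t^h by [h]_q! turns these weights into the weights 1 and
    [h]_q^2 of the path count (lemma [path_sum_Qpoly]).

    The recursion on paths is proved without any bijection: [state_sum R M] is
    the sum over the s whose arcs in the region R are exactly those of M, and
    enlarging R by one row or one column splits it according to the single arc
    that may appear there ([state_sum_strip]). *)

Set Implicit Arguments.
Unset Strict Implicit.
Unset Printing Implicit Defensive.

Import Order.TTheory GRing.Theory Num.Theory.
Local Open Scope ring_scope.

(** * Arcs and crossings *)

Section Arcs.
Variable n : nat.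
Implicit Types (s : {perm letter n}) (i j k : 'I_n).

Definition arc := ('I_n * letter n)%type.
Implicit Types (p o : arc) (M R : {set arc}).

Definition arcs s : {set arc} := [set p | s (p.1, false) == p.2].

Lemma letter_oppK : involutive (@letter_opp n).
Proof. by case=> i b; rewrite /letter_opp /= negbK. Qed.

Lemma BsetN s x : s \in Bset n -> s (letter_opp x) = letter_opp (s x).
Proof. by rewrite inE => /forallP/(_ x)/eqP. Qed.

Lemma mem_arcs s i : (i, s (i, false)) \in arcs s.
Proof. by rewrite inE. Qed.

Lemma arcs_source_inj s : {in arcs s &, injective fst}.
Proof.
by move=> [i x] [j z]; rewrite !inE /= => /eqP <- /eqP <- /= ->.
Qed.

Lemma arcs_target_inj s : s \in Bset n ->
  {in arcs s &, injective (fun p => p.2.1)}.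
Proof.
move=> sB [i x] [j z]; rewrite !inE /= => /eqP <- /eqP <- /= eq_abs.
have [/perm_inj[->]//|ne_s] := eqVneq (s (i, false)) (s (j, false)).
have: s (i, false) = letter_opp (s (j, false)).
  move: ne_s eq_abs; rewrite /letter_opp.
  case: (s (i, _)) => a c; case: (s (j, _)) => b d /= + eq_ab.
  by rewrite eq_ab; case: c; case: d; rewrite ?eqxx.
by rewrite -BsetN // => /perm_inj.
Qed.

Lemma arcs_target_ex s j : s \in Bset n -> exists2 p, p \in arcs s & p.2.1 = j.
Proof.
move=> sB; set x := (s^-1)%g (j, false).
have sx : s x = (j, false) by rewrite permKV.
case: x sx => i [] sx; last by exists (i, (j, false)); rewrite ?inE ?sx.
exists (i, (j, true)) => //.
by rewrite inE /= -[(i, false)]/(letter_opp (i, true)) BsetN // sx.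
Qed.

Lemma card_arcs s (P : pred arc) :
  #|[set p in arcs s | P p]| = #|[set i | P (i, s (i, false))]|.
Proof.
rewrite -(card_in_imset (f := fst)); last first.
  by move=> p o; rewrite !inE => /andP[ps _] /andP[os _];
     apply: (@arcs_source_inj s); rewrite inE.
apply: eq_card => i; rewrite inE; apply/imsetP/idP => [[[j x]]|Pi].
  by rewrite !inE /= => /andP[/eqP <- Pj] ->.
by exists (i, s (i, false)); rewrite ?inE ?eqxx.
Qed.

(** The two kinds of crossing are charged to one of their arcs, the first
    argument p: the arc that is drawn first when the points are uncovered from
    right to left.  Among crossing upper arcs it is the one whose source is
    further right, where o may also be replaced by its mirror image, from -i to
    -s_i; among lower arcs it is the one whose target is further right. *)
Definition upper_cross p o : bool :=
  [&& pos o.1 < pos p.1, pos p.1 <= letter_val o.2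
    & letter_val o.2 < letter_val p.2]
  || [&& - pos o.1 < pos p.1, pos p.1 <= - letter_val o.2
    & - letter_val o.2 < letter_val p.2].

Definition lower_cross p o : bool :=
  [&& pos p.1 > pos o.1, pos o.1 > letter_val p.2
    & letter_val p.2 > letter_val o.2].

Definition cross p o := upper_cross p o || lower_cross p o.

Lemma card_exclusive_or (I : finType) (P Q : pred I) :
  (forall e, ~~ (P e && Q e)) ->
  #|[set e | P e || Q e]| = (\sum_e (P e + Q e))%N.
Proof.
move=> PQ; rewrite -sum1_card big_mkcond /=; apply: eq_bigr => e _.
by rewrite inE; move: (PQ e); case: (P e); case: (Q e).
Qed.

Lemma cro_BE s :
  cro_B s = (\sum_i #|[set o in arcs s | cross (i, s (i, false)) o]|)%N.
Proof.
pose a i : arc := (i, s (i, false)).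
transitivity (\sum_i \sum_j
    (upper_cross (a j) (a i) + lower_cross (a i) (a j)))%N.
  rewrite pair_bigA -card_exclusive_or => [|[i j]]; last first.
    by rewrite /upper_cross /lower_cross /pos /=; lia.
  by apply: eq_card => -[i j]; rewrite !inE /crossing orbA.
under [RHS]eq_bigr => i _ do rewrite card_arcs.
under [RHS]eq_bigr => i _.
  rewrite card_exclusive_or => [|j]; last first.
    by rewrite /upper_cross /lower_cross /pos /=; lia.
  rewrite big_split; over.
under eq_bigr => i _ do rewrite big_split.
by rewrite !big_split /= [X in (X + _ = _)%N]exchange_big.
Qed.

End Arcs.

(** * Weights and revealed regions *)

Section Weights.
Variables (n : nat) (F : fieldType) (y q : F) (phi : nat -> F).
Implicit Types (s : {perm letter n}) (i j k : 'I_n).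
Implicit Types (p o : arc n) (M R : {set arc n}).

(** The value 0 on loops restricts every sum below to permutations without
    fixed points. *)
Definition arc_weight p : F :=
  if letter_val p.2 == pos p.1 then 0
  else if pos p.1 <= letter_val p.2 then y else 1.

Definition weight s p : F :=
  arc_weight p * q ^+ #|[set o in arcs s | cross p o]|.

Lemma prod_arcs s (G : arc n -> F) :
  \prod_(p in arcs s) G p = \prod_i G (i, s (i, false)).
Proof.
rewrite (reindex_onto (fun i : 'I_n => (i, s (i, false))) fst) /=.
  by apply: eq_bigl => i; rewrite !inE !eqxx.
by move=> [i x]; rewrite inE /= => /eqP <-.
Qed.

Lemma prod_weight s : \prod_(p in arcs s) weight s p =
  if fixfree s then y ^+ wex s * q ^+ cro_B s else 0.
Proof.
rewrite prod_arcs; case: ifPn => [/forallP s_ff | /forallPn[i /negPn fix_i]].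
  rewrite big_split /= cro_BE expr_sum; congr (_ * _).
  rewrite /wex -prodr_const [RHS]big_mkcond /=; apply: eq_bigr => i _.
  by rewrite /arc_weight inE -/(entry s i) (negPf (s_ff i)).
by rewrite (bigD1 i) //= /weight /arc_weight -/(entry s i) fix_i !mul0r.
Qed.

(** Only the arcs outside R are weighted: those of M have been paid for when
    they were revealed. *)
Definition state_sum R M : F :=
  \sum_(s in Bset n | arcs s :&: R == M)
    (\prod_(p in arcs s :\: R) weight s p) * phi (neg s).

Lemma state_sum0 : state_sum set0 set0 =
  \sum_(s in Bset n) (if fixfree s then y ^+ wex s * q ^+ cro_B s else 0)
    * phi (neg s).
Proof.
apply: eq_big => [s|s _]; first by rewrite setI0 eqxx andbT.
by rewrite setD0 prod_weight.
Qed.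

(** The basic step: R grows by a strip which contains at most one arc of each s,
    since it lies in a single row or a single column.  Either no arc lies in
    the strip, or exactly one does, and it is one of the candidates [e b]; its
    weight is constant on the class, so it factors out. *)
Lemma state_sum_strip R R' M (e : 'I_n -> arc n) (J : {set 'I_n})
    (v : 'I_n -> F) :
  R \subset R' -> M \subset R ->
  {in J, forall b, e b \in R' :\: R} ->
  (forall s, s \in Bset n -> arcs s :&: R = M ->
     forall p, p \in arcs s -> p \in R' :\: R ->
     exists2 b, b \in J & p = e b) ->
  (forall s b b', s \in Bset n ->
     e b \in arcs s -> e b' \in arcs s -> b = b') ->
  (forall s b, s \in Bset n -> b \in J -> arcs s :&: R' = e b |: M ->
     weight s (e b) = v b) ->
  state_sum R M
    = state_sum R' M + \sum_(b in J) v b * state_sum R' (e b |: M).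
Proof.
move=> RR' MR eJ new uniq_e vE.
pose hit s b := (b \in J) && (e b \in arcs s).
have IR s : arcs s :&: R' :&: R = arcs s :&: R by rewrite -setIA (setIidPr RR').
have M_R p : p \in M -> p \in R by move=> /(subsetP MR).
have hitE s b : s \in Bset n -> b \in J ->
    (arcs s :&: R == M) && (e b \in arcs s) = (arcs s :&: R' == e b |: M).
  move=> sB bJ; have := eJ _ bJ; rewrite in_setD => /andP[ebR ebR'].
  apply/andP/eqP => [[/eqP sM eb_s] | sM]; last first.
    split; last by have := setU11 (e b) M; rewrite -sM in_setI => /andP[].
    rewrite -IR sM setIUl (setIidPl MR) (_ : _ :&: R = set0) ?set0U //.
    apply/setP=> p; rewrite in_setI in_set1 in_set0; case: eqP => // ->.
    by rewrite (negPf ebR).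
  apply/setP=> p; rewrite in_setI in_setU1 -sM.
  have [->|ne_p] := eqVneq p (e b); first by rewrite eb_s ebR'.
  rewrite in_setI /=; case ps: (p \in arcs s) => //=; apply/idP/idP => [pR'|].
    have [//|pR] := boolP (p \in R).
    have pN : p \in R' :\: R by rewrite in_setD pR pR'.
    have [b' b'J pe] := new s sB sM p ps pN.
    by rewrite pe (uniq_e s b' b) -?pe ?eqxx // in ne_p.
  exact: (subsetP RR').
have missE s : s \in Bset n ->
    (arcs s :&: R == M) && ~~ [exists b, hit s b] = (arcs s :&: R' == M).
  move=> sB; apply/andP/eqP => [[/eqP sM nohit] | sM].
    apply/setP=> p; rewrite -sM !in_setI.
    case ps: (p \in arcs s) => //=; apply/idP/idP => [pR'|];
      last exact: (subsetP RR').
    have [//|pR] := boolP (p \in R).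
    have pN : p \in R' :\: R by rewrite in_setD pR pR'.
    have [b bJ pe] := new s sB sM p ps pN.
    by case/existsP: nohit; exists b; rewrite /hit bJ -pe.
  split; first by rewrite -IR sM (setIidPl MR).
  apply/existsPn=> b; apply/negP=> /andP[bJ eb_s].
  have := eJ _ bJ; rewrite in_setD => /andP[ebR ebR'].
  by have := M_R (e b); rewrite -sM in_setI eb_s ebR' (negPf ebR) => /(_ isT).
(* Since at most one candidate is an arc of s, the summand of s occurs exactly
   once in the split sum. *)
pose G s := (\prod_(p in arcs s :\: R) weight s p) * phi (neg s).
have splitG s : s \in Bset n -> G s =
    (if ~~ [exists b, hit s b] then G s else 0)
     + \sum_(b in J) if e b \in arcs s then G s else 0.
  move=> sB; case: existsP => [[b /andP[bJ eb]] | nohit] /=.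
    rewrite add0r (bigD1 b) //= eb big1 ?addr0 // => b' /andP[_ ne_b].
    by case: ifP => // eb'; rewrite (uniq_e s b b') ?eqxx in ne_b.
  rewrite big1 ?addr0 // => b bJ; case: ifP => // eb.
  by case: nohit; exists b; rewrite /hit bJ.
rewrite /state_sum
  (eq_bigr (fun s => (if ~~ [exists b, hit s b] then G s else 0)
     + \sum_(b in J) if e b \in arcs s then G s else 0)); last first.
  by move=> s /andP[sB _]; rewrite -splitG.
rewrite big_split exchange_big /=; congr (_ + _).
  rewrite -big_mkcondr; apply: eq_big => [s | s /andP[/andP[sB sM] nohit]].
    by rewrite -andbA; apply: andb_id2l; apply: missE.
  congr (_ * _); apply: eq_bigl => p; rewrite !in_setD.
  have sM' : arcs s :&: R' = M by apply/eqP; rewrite -missE ?sM.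
  case ps: (p \in arcs s); rewrite ?andbF // !andbT; congr (~~ _).
  by rewrite -[LHS]andTb -[RHS]andTb -ps -!in_setI sM' (eqP sM).
apply: eq_bigr => b bJ; rewrite mulr_sumr -big_mkcondr /=.
apply: eq_big => [s | s /andP[/andP[sB sM] eb]].
  by rewrite -andbA; apply: andb_id2l => sB; apply: hitE.
have sM' : arcs s :&: R' = e b |: M by apply/eqP; rewrite -hitE ?sM.
have := eJ _ bJ; rewrite in_setD => /andP[ebR ebR'].
rewrite /G (bigD1 (e b)) /=; last by rewrite in_setD eb ebR.
rewrite (vE s b) // -mulrA; congr (_ * (_ * _)); apply: eq_bigl => p.
rewrite !in_setD; case ps: (p \in arcs s); rewrite ?andbF // !andbT.
have: (p \in arcs s :&: R') = (p \in e b |: M) by rewrite sM'.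
have: (p \in arcs s :&: R) = (p \in M) by rewrite (eqP sM).
rewrite !in_setI in_setU1 ps /= => <- ->; case: eqP => [->|_];
  by rewrite ?andbF ?andbT ?orbT.
Qed.


(** * Revealing one point *)

Definition sources M : {set 'I_n} := [set p.1 | p in M].
Definition targets M : {set 'I_n} := [set p.2.1 | p in M].

Definition free_sources a M : {set 'I_n} :=
  [set i : 'I_n | (a <= i)%N && (i \notin sources M)].
Definition free_targets a M : {set 'I_n} :=
  [set j : 'I_n | (a <= j)%N && (j \notin targets M)].

Definition quadrant (a b : nat) : {set arc n} :=
  [set p : arc n | [&& (a <= p.1)%N, (b <= p.2.1)%N & ~~ p.2.2]].

(** Used after all positive targets: the negative targets -1, -2, ... are then
    revealed in this order. *)
Definition sweep (m : nat) : {set arc n} :=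
  [set p : arc n | p.2.2 ==> (p.2.1 < m)%N].

Definition rank (J : {set 'I_n}) (b : 'I_n) : nat :=
  #|[set j in J | (j < b)%N]|.

(** Each row contains one arc, so the arc at a given source lies outside the
    region exactly when that source does not occur among the revealed arcs.
    This turns crossing counts, which depend on s, into counts of free points,
    which depend on M only. *)
Lemma unrevealed_source s R M o : arcs s :&: R = M -> o \in arcs s ->
  (o \notin R) = (o.1 \notin sources M).
Proof.
move=> sM os; congr (~~ _); apply/idP/imsetP => [oR | [p pM eq_op]].
  by exists o => //; rewrite -sM in_setI os oR.
move: pM; rewrite -sM in_setI => /andP[ps].
by rewrite (arcs_source_inj os ps eq_op).
Qed.

Lemma unrevealed_target s R M o : s \in Bset n ->
  arcs s :&: R = M -> o \in arcs s ->
  (o \notin R) = (o.2.1 \notin targets M).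
Proof.
move=> sB sM os; congr (~~ _); apply/idP/imsetP => [oR | [p pM eq_op]].
  by exists o => //; rewrite -sM in_setI os oR.
move: pM; rewrite -sM in_setI => /andP[ps].
by rewrite (arcs_target_inj sB os ps eq_op).
Qed.

Lemma card_by_source s (P : pred (arc n)) (A : {set 'I_n}) :
  {in arcs s, forall o, P o = (o.1 \in A)} ->
  #|[set o in arcs s | P o]| = #|A|.
Proof.
move=> PA; rewrite card_arcs; apply: eq_card => i.
by rewrite inE PA // mem_arcs.
Qed.

Lemma card_by_target s (P : pred (arc n)) (A : {set 'I_n}) : s \in Bset n ->
  {in arcs s, forall o, P o = (o.2.1 \in A)} ->
  #|[set o in arcs s | P o]| = #|A|.
Proof.
move=> sB PA.
rewrite -(card_in_imset (f := fun o : arc n => o.2.1)); last first.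
  move=> p o; rewrite inE => /andP[ps _]; rewrite inE => /andP[os _].
  exact: (arcs_target_inj sB).
apply: eq_card => j; apply/imsetP/idP => [[o]|jA].
  by rewrite inE => /andP[os]; rewrite PA // => + ->.
have [o os oj] := arcs_target_ex j sB.
by exists o => //; rewrite inE os PA // oj.
Qed.

Lemma sourcesU1 p M : sources (p |: M) = p.1 |: sources M.
Proof. by rewrite /sources imsetU1. Qed.

Lemma targetsU1 p M : targets (p |: M) = p.2.1 |: targets M.
Proof. by rewrite /targets imsetU1. Qed.

(** The arc out of the source b > k into k is a lower arc; the arcs it crosses
    start at the points between k and b and go further left than k, so they are
    the ones at the free sources smaller than b. *)
Lemma target_step k M : M \subset quadrant k.+1 k.+1 ->
  let L := free_sources k.+1 M in
  state_sum (quadrant k.+1 k.+1) M = state_sum (quadrant k.+1 k) M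
   + \sum_(b in L) q ^+ rank L b
       * state_sum (quadrant k.+1 k) ((b, (k, false)) |: M).
Proof.
move=> MR /=; apply: (state_sum_strip (e := fun b => (b, (k, false)))) => //.
- apply/subsetP=> p; rewrite !inE => /and3P[-> lt_k ->].
  by rewrite (ltnW lt_k).
- by move=> b; rewrite !inE /= leqnn ltnn /= andbF andbT => /andP[].
- move=> s sB sM p ps; rewrite in_setD => /andP[pR pR']; exists p.1.
    rewrite inE -(unrevealed_source sM ps) pR andbT.
    by move: pR'; rewrite inE => /and3P[].
  case: p pR pR' {ps} => i [j c]; rewrite !inE /= => pR /and3P[lt_ki le_kj c0].
  move: pR; rewrite lt_ki c0 /= andbT -leqNgt => le_jk.
  rewrite (negPf c0); congr (_, (_, _)); apply: val_inj; apply/eqP.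
  by rewrite eqn_leq le_jk.
- by move=> s b b' sB bs b's; case: (arcs_target_inj sB bs b's erefl).
move=> s b sB; rewrite inE => /andP[lt_kb bM] sM.
rewrite /weight (_ : arc_weight _ = 1) ?mul1r; last first.
  rewrite /arc_weight /letter_val /pos /=.
  by case: eqP => [|_]; [lia | case: leP => //; lia].
congr (_ ^+ _); apply: card_by_source => o os.
rewrite !inE -andbA.
have := unrevealed_source sM os; rewrite sourcesU1 !inE negb_or /= => uo.
(* An arc whose source is to the right of k lies outside the revealed region
   when its target is negative or smaller than k. *)
have -> : cross (b, (k, false)) o =
    [&& (k < o.1)%N, (o.1 < b)%N & o \notin quadrant k.+1 k].
  rewrite inE; case: o {os uo} => i [j c].
  rewrite /cross /upper_cross /lower_cross /letter_val /pos /=.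
  by case: c => /=; lia.
rewrite inE uo; case: (k < o.1)%N => //=; rewrite [RHS]andbC.
by case: (ltnP o.1 b) => //= lt_ob; rewrite -val_eqE (ltn_eqF lt_ob).
Qed.

(** The arc from k to a > k crosses the arcs that end at the free targets in
    [k, a[, whether these come from a smaller position or from a negative one.
    When k itself is free it belongs to this range: touching upper
    arcs count as crossing. *)
Lemma source_step k M : M \subset quadrant k.+1 k ->
  let U := free_targets k M in
  state_sum (quadrant k.+1 k) M = state_sum (quadrant k k) M
   + \sum_(a in U) (if a == k then 0 else y * q ^+ rank U a)
       * state_sum (quadrant k k) ((k, (a, false)) |: M).
Proof.
move=> MR /=; apply: (state_sum_strip (e := fun a => (k, (a, false)))) => //.
- by apply/subsetP=> p; rewrite !inE => /and3P[/ltnW -> -> ->].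
- by move=> a; rewrite !inE /= leqnn ltnn /= andbT => /andP[].
- move=> s sB sM p ps; rewrite in_setD => /andP[pR pR']; exists p.2.1.
    rewrite inE -(unrevealed_target sB sM ps) pR andbT.
    by move: pR'; rewrite inE => /and3P[].
  case: p pR pR' {ps} => i [j c]; rewrite !inE /= => pR /and3P[le_ki le_kj c0].
  move: pR; rewrite le_kj c0 /= andbT -leqNgt => le_ik.
  rewrite (negPf c0); congr (_, _); apply: val_inj; apply/eqP.
  by rewrite eqn_leq le_ik.
- by move=> s a a' sB ka ka'; case: (arcs_source_inj ka ka' erefl).
move=> s a sB; rewrite inE => /andP[le_ka aM] sM; rewrite /weight /arc_weight.
have [->|ne_ak] := eqVneq a k; first by rewrite /letter_val /pos /= eqxx mul0r.
have lt_ka : (k < a)%N by rewrite ltn_neqAle eq_sym ne_ak.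
have -> : (letter_val (a, false) == pos k) = false.
  by apply/negbTE; rewrite /letter_val /pos /=; lia.
have -> : pos k <= letter_val (a, false) by rewrite /letter_val /pos /=; lia.
congr (_ * _ ^+ _); apply: card_by_target => // o os.
rewrite !inE -andbA.
have := unrevealed_target sB sM os; rewrite targetsU1 !inE negb_or /= => uo.
have -> : cross (k, (a, false)) o =
    [&& (k <= o.2.1)%N, (o.2.1 < a)%N & o \notin quadrant k k].
  rewrite inE; case: o {os uo} => i [j c].
  rewrite /cross /upper_cross /lower_cross /letter_val /pos /=.
  by case: c => /=; lia.
rewrite inE uo; case: (k <= o.2.1)%N => //=; rewrite [RHS]andbC.
by case: (ltnP o.2.1 a) => //= lt_oa; rewrite -val_eqE (ltn_eqF lt_oa).
Qed.

Lemma sweep_subset k : sweep k \subset sweep k.+1.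
Proof.
by apply/subsetP=> p; rewrite !inE; case: p.2.2 => //= /ltnW.
Qed.

(** Exactly one of k and -k is an entry of s, so nothing is left to reveal at -k
    if k is already known to be an entry. *)
Lemma sweep_skip k M : M \subset sweep k -> k \in targets M ->
  state_sum (sweep k) M = state_sum (sweep k.+1) M.
Proof.
move=> MR kM; rewrite [LHS](state_sum_strip (R' := sweep k.+1)
  (e := fun b => (b, (k, true))) (J := set0) (v := fun=> 0)) //.
- by rewrite big_set0 addr0.
- exact: sweep_subset.
- by move=> b; rewrite inE.
- move=> s sB sM p ps; rewrite in_setD => /andP[pR pR'].
  have := unrevealed_target sB sM ps; rewrite pR => /esym.
  suff -> : p.2.1 = k by rewrite kM.
  apply: val_inj; move: pR pR'; rewrite !inE.
  case: p.2.2 => //=; rewrite ltnS -leqNgt => le1 le2.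
  by apply/eqP; rewrite eqn_leq le1 le2.
- by move=> s b b' sB bs b's; case: (arcs_target_inj sB bs b's erefl).
- by move=> s b _; rewrite inE.
Qed.

(** When k is known not to be an entry of s, -k must be one; the case without
    an arc in the strip is then empty. *)
Lemma sweep_step k M : M \subset sweep k -> k \notin targets M ->
  let L := free_sources 0 M in
  state_sum (sweep k) M =
    \sum_(b in L) q ^+ rank L b * state_sum (sweep k.+1) ((b, (k, true)) |: M).
Proof.
move=> MR kM /=.
have miss0 : state_sum (sweep k.+1) M = 0.
  apply: big1 => s /andP[sB /eqP sM]; have [p ps pk] := arcs_target_ex k sB.
  have := unrevealed_target sB sM ps; rewrite pk kM.
  by rewrite inE pk leqnn implybT.
rewrite -[RHS]add0r -[X in X + _]miss0.
apply: (state_sum_strip (e := fun b => (b, (k, true)))) => //.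
- exact: sweep_subset.
- by move=> b; rewrite !inE /= ltnn ltnS leqnn.
- move=> s sB sM p ps; rewrite in_setD => /andP[pR pR']; exists p.1.
    by rewrite inE -(unrevealed_source sM ps) pR.
  case: p pR pR' {ps} => i [j [|]]; rewrite !inE //= => pR pR'.
  congr (_, (_, _)); apply: val_inj.
  by apply/eqP; rewrite eqn_leq -ltnS pR' leqNgt.
- by move=> s b b' sB bs b's; case: (arcs_target_inj sB bs b's erefl).
move=> s b sB; rewrite inE => /andP[_ bM] sM.
rewrite /weight (_ : arc_weight _ = 1) ?mul1r; last first.
  by [].
congr (_ ^+ _); apply: card_by_source => o os.
rewrite !inE /=.
have := unrevealed_source sM os; rewrite sourcesU1 !inE negb_or /= => uo.
have -> : cross (b, (k, true)) o = (o.1 < b)%N && (o \notin sweep k.+1).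
  rewrite inE; case: o {os uo} => i [j c].
  rewrite /cross /upper_cross /lower_cross /letter_val /pos /=.
  by case: c => /=; lia.
rewrite inE uo [RHS]andbC.
by case: (ltnP o.1 b) => //= lt_ob; rewrite -val_eqE (ltn_eqF lt_ob).
Qed.


(** * Free points and q-counting *)

Definition matching M : Prop :=
  {in M &, injective fst} /\ {in M &, injective (fun p => p.2.1)}.

Definition negatives M : nat := #|[set p in M | p.2.2]|.

Definition qfact h : F := \prod_(i < h) qint q i.+1.

(** The weighted count of the Motzkin paths with k steps that start at height
    h.  For h = 0 the down step has weight 0, so the value h.-1 = 0 there is
    harmless. *)
Fixpoint path_sum (k h : nat) : F :=
  if k is k'.+1 then
    path_sum k' h.+1 + (1 + y * q) * qint q h * path_sum k' h
      + y * qint q h ^+ 2 * path_sum k' h.-1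
  else qfact h * phi h.

Lemma qintS m : qint q m.+1 = qint q m + q ^+ m.
Proof. by rewrite /qint big_ord_recr. Qed.

Lemma qintSl m : qint q m.+1 = 1 + q * qint q m.
Proof.
rewrite /qint big_ord_recl mulr_sumr; congr (_ + _).
by apply: eq_bigr => i _; rewrite exprS.
Qed.

(** The ranks of the elements of J are 0, 1, ..., #|J| - 1. *)
Lemma sum_rank (J : {set 'I_n}) : \sum_(b in J) q ^+ rank J b = qint q #|J|.
Proof.
have [h hJ] := ubnP #|J|; elim: h => // h IH in J hJ *.
have [->|/set0Pn[b0 b0J]] := eqVneq J set0.
  by rewrite big_set0 cards0 /qint big_ord0.
case: (@arg_maxnP _ b0 (mem J) val b0J) => m mJ m_max.
rewrite -[mem J m]/(m \in J) in mJ.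
have ltm j : j \in J :\ m -> (j < m)%N.
  rewrite !inE => /andP[ne_jm /m_max le_jm].
  by rewrite ltn_neqAle val_eqE ne_jm.
rewrite (big_setD1 m) //= (cardsD1 m J) mJ qintS addrC; congr (_ + _).
  rewrite -IH; last by move: hJ; rewrite (cardsD1 m J) mJ.
  apply: eq_bigr => b /ltm lt_bm; congr (_ ^+ _); apply: eq_card => j.
  by rewrite !inE; case: eqP => // ->; rewrite ltnNge (ltnW lt_bm) andbF.
congr (_ ^+ _); apply: eq_card => j; apply/idP/idP => [|jJ]; last first.
  by rewrite inE ltm // andbT; move: jJ; rewrite inE => /andP[].
by rewrite !inE => /andP[-> lt_jm]; rewrite -val_eqE (ltn_eqF lt_jm).
Qed.

Lemma free_sourcesU1 a p M :
  free_sources a (p |: M) = free_sources a M :\ p.1.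
Proof.
by apply/setP=> i; rewrite !inE sourcesU1 !inE negb_or andbCA.
Qed.

Lemma free_targetsU1 a p M :
  free_targets a (p |: M) = free_targets a M :\ p.2.1.
Proof.
by apply/setP=> i; rewrite !inE targetsU1 !inE negb_or andbCA.
Qed.

Lemma free_sourcesS k M : free_sources k.+1 M = free_sources k M :\ k.
Proof.
by apply/setP=> i; rewrite !inE andbA ltn_neqAle val_eqE eq_sym.
Qed.

Lemma free_targetsS k M : free_targets k.+1 M = free_targets k M :\ k.
Proof.
by apply/setP=> i; rewrite !inE andbA ltn_neqAle val_eqE eq_sym.
Qed.

Lemma matchingU1 p M : matching M -> p.1 \notin sources M ->
  p.2.1 \notin targets M -> matching (p |: M).
Proof.
move=> [Ms Mt] ps pt; split=> o o'; rewrite !in_setU1.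
  case/predU1P=> [->|oM] /predU1P[->|o'M] //.
  - by move=> e; rewrite e (imset_f fst) in ps.
  - by move=> e; rewrite -e (imset_f fst) in ps.
  - exact: Ms.
case/predU1P=> [->|oM] /predU1P[->|o'M] //.
- by move=> /= e; rewrite e (imset_f (fun p => p.2.1)) in pt.
- by move=> /= e; rewrite -e (imset_f (fun p => p.2.1)) in pt.
- exact: Mt.
Qed.

Lemma neg_arcs s : neg s = negatives (arcs s).
Proof.
rewrite /negatives card_arcs; apply: eq_card => i.
by rewrite !inE /entry /letter_val; case: (s _).2.
Qed.

(** * Summing over all completions *)

(** The final classes of the decomposition are not empty.  The
    permutation of the 2n letters is the odd extension of the function whose
    graph is M. *)
Lemma matching_perm M : matching M -> (forall i, i \in sources M) ->
  exists2 s, s \in Bset n & arcs s = M.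
Proof.
move=> [Ms Mt] Mfull.
pose f i := odflt (i, false) [pick x | (i, x) \in M].
have fM i : (i, f i) \in M.
  rewrite /f; case: pickP => //= no; case/imsetP: (Mfull i) => -[j x] jM ij.
  by move: (no x); rewrite ij jM.
pose h (x : letter n) := if x.2 then letter_opp (f x.1) else f x.1.
have h_inj : injective h.
  have h1 x : (h x).1 = (f x.1).1 by rewrite /h; case: x.2.
  move=> [i b] [j c] hij.
  have eq_ij : i = j.
    have := Mt _ _ (fM i) (fM j); rewrite -(h1 (i, b)) -(h1 (j, c)) hij.
    by case/(_ erefl).
  move: hij; rewrite -eq_ij /h /=; case: (f i) => a d.
  by case: b; case: c => //= -[]; case: d.
exists (perm h_inj).
  rewrite inE; apply/forallP=> x; rewrite !permE /h /=.
  by case: x.2; rewrite //= letter_oppK.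
apply/setP=> -[i x]; rewrite inE permE /h /=; apply/eqP/idP => [<- //|ixM].
by have [] := Ms _ _ (fM i) ixM erefl.
Qed.

(** The h free sources take the h free targets, all with negative sign.  Going
    through the targets -1, -2, ... there are h, then h - 1, ... sources to
    choose from, each choice giving a factor [h]_q, [h-1]_q, ... *)
Lemma sum_sweep (d k h : nat) M :
  (k + d)%N = n -> M \subset sweep k -> matching M ->
  (forall j, (j < k)%N -> j \in targets M) ->
  #|free_sources 0 M| = h -> #|free_targets 0 M| = h ->
  state_sum (sweep k) M = qfact h * phi (h + negatives M).
Proof.
elim: d k h M => [|d IH] k h M.
  rewrite addn0 => -> _ Mm Mt Lh Uh.
  have h0 : h = 0%N.
    rewrite -Uh; apply/eqP; rewrite cards_eq0; apply/eqP/setP=> j.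
    by rewrite !inE Mt.
  rewrite h0 /qfact big_ord0 mul1r.
  have [|s0 s0B s0M] := matching_perm Mm.
    move=> i; apply/negPn/negP=> iM.
    have: i \in free_sources 0 M by rewrite inE.
    by move/eqP: Lh; rewrite h0 cards_eq0 => /eqP ->; rewrite inE.
  have sweepT : sweep n = setT by apply/setP=> p; rewrite !inE ltn_ord implybT.
  rewrite /state_sum sweepT (big_pred1 s0) => [|s].
    rewrite setDT big_set0 mul1r neg_arcs s0M //.
  rewrite setIT -s0M; apply/andP/eqP => [[sB /eqP eq_arcs]|->//].
  have on_pos i : s (i, false) = s0 (i, false).
    by have := mem_arcs s i; rewrite eq_arcs inE => /eqP.
  apply/permP=> -[i [|]]; last exact: on_pos.
  by rewrite -[(i, true)]/(letter_opp (i, false)) !BsetN // on_pos.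
move=> kd MR Mm Mt Lh Uh.
have lt_kn : (k < n)%N by rewrite -kd -addSnnS leq_addr.
pose k' := Ordinal lt_kn.
have Mt' M' : {subset targets M <= targets M'} -> k' \in targets M' ->
    forall j, (j < k.+1)%N -> j \in targets M'.
  move=> sub k'M j; rewrite ltnS leq_eqVlt => /predU1P[jk|/Mt/sub//].
  by rewrite (_ : j = k') //; apply: val_inj.
have [k'M|k'M] := boolP (k' \in targets M).
  rewrite -[sweep k]/(sweep k') sweep_skip //.
  apply: IH => //; first by rewrite addSnnS.
  - by apply: subset_trans MR _; apply: (sweep_subset k').
  - exact: Mt'.
rewrite -[sweep k]/(sweep k') sweep_step // -[RHS]mul1r.
case: h Lh Uh => [|h] Lh Uh.
  have: k' \in free_targets 0 M by rewrite inE.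
  by move/eqP: Uh; rewrite cards_eq0 => /eqP ->; rewrite inE.
rewrite (eq_bigr (fun b => q ^+ rank (free_sources 0 M) b
    * (qfact h * phi (h.+1 + negatives M)))); last first.
  move=> b bL; congr (_ * _).
  have bM : b \notin sources M by move: bL; rewrite inE.
  rewrite (IH k.+1 h).
  - congr (_ * phi _); rewrite addSnnS; congr (_ + _)%N.
    rewrite /negatives (cardsD1 (b, (k', true))) !inE eqxx /= add1n; congr _.+1.
    apply: eq_card => p; rewrite !inE; case: eqP => [->|//] /=.
    apply/esym/negP=> /andP[bkM _]; case/negP: bM.
    exact: (imset_f fst bkM).
  - by rewrite addSnnS.
  - rewrite subUset sub1set inE /= ltnSn /=.
    by apply: subset_trans MR _; apply: (sweep_subset k').
  - exact: matchingU1.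
  - apply: Mt' => [j|]; rewrite targetsU1 !inE ?eqxx // => ->.
    by rewrite orbT.
  - by move: Lh; rewrite free_sourcesU1 (cardsD1 b) bL => -[].
  - by move: Uh; rewrite free_targetsU1 (cardsD1 k') inE /= k'M => -[].
rewrite -mulr_suml sum_rank Lh mul1r /qfact big_ord_recr /=.
by rewrite mulrA [qint _ _ * _]mulrC.
Qed.

Lemma free_sources_card k M : k \notin sources M ->
  #|free_sources k M| = #|free_sources k.+1 M|.+1.
Proof. by move=> kM; rewrite free_sourcesS (cardsD1 k) inE leqnn kM. Qed.

Lemma free_targets_card k M : k \notin targets M ->
  #|free_targets k M| = #|free_targets k.+1 M|.+1.
Proof. by move=> kM; rewrite free_targetsS (cardsD1 k) inE leqnn kM. Qed.

Lemma notin_sources a b k M : M \subset quadrant a b -> (k < a)%N ->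
  k \notin sources M.
Proof.
move=> MR lt_ka; apply/imsetP=> -[p /(subsetP MR)].
by rewrite inE => /andP[le_ap _] kp; rewrite kp ltnNge le_ap in lt_ka.
Qed.

Lemma notin_targets a b k M : M \subset quadrant a b -> (k < b)%N ->
  k \notin targets M.
Proof.
move=> MR lt_ka; apply/imsetP=> -[p /(subsetP MR)].
by rewrite inE => /and3P[_ le_bp _] kp; rewrite kp ltnNge le_bp in lt_ka.
Qed.

Lemma quadrant_subset (a b a' b' : nat) : (a' <= a)%N -> (b' <= b)%N ->
  quadrant a b \subset quadrant a' b'.
Proof.
move=> le_a le_b; apply/subsetP=> p; rewrite !inE => /and3P[pa pb ->].
by rewrite (leq_trans le_a pa) (leq_trans le_b pb).
Qed.

Definition level_sum_spec (k : nat) : Prop := forall h M,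
  M \subset quadrant k k -> matching M ->
  #|free_sources k M| = h -> #|free_targets k M| = h ->
  state_sum (quadrant k k) M = path_sum k h.

(** Revealing the arc out of k.  The sum of q^rank over the free targets a > k
    is [l+1]_q if k is not free as a target; otherwise it is [l+1]_q - 1,
    because k is then the smallest free target, of rank 0, and is excluded: a
    loop has weight 0. *)
Lemma half_level_sum k l M : level_sum_spec k ->
  M \subset quadrant k.+1 k -> matching M ->
  #|free_sources k.+1 M| = l -> #|free_targets k M| = l.+1 ->
  state_sum (quadrant k.+1 k) M = path_sum k l.+1
    + y * (qint q l.+1 - (k \notin targets M)%:R) * path_sum k l.
Proof.
move=> IH MR Mm Ll Ul; have kM := notin_sources MR (ltnSn k).
rewrite source_step // (IH l.+1) //; last first.
- by rewrite free_sources_card ?Ll.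
- by apply: subset_trans MR _; apply: quadrant_subset.
congr (_ + _).
rewrite (eq_bigr (fun a =>
     (if a == k then 0 else y * q ^+ rank (free_targets k M) a)
   * path_sum k l)); last first.
  move=> a aU; congr (_ * _).
  have aM : a \notin targets M by move: aU; rewrite inE => /andP[].
  apply: IH.
  - rewrite subUset sub1set inE /= leqnn /=.
    move: (aU); rewrite inE => /andP[-> _] /=.
    by apply: subset_trans MR _; apply: quadrant_subset.
  - exact: matchingU1.
  - by rewrite free_sourcesU1 -free_sourcesS.
  - by move: Ul; rewrite free_targetsU1 (cardsD1 a) aU => -[].
rewrite -mulr_suml; congr (_ * _); rewrite -Ul -sum_rank.
have [kT|kT] /= := boolP (k \in targets M).
  rewrite subr0 mulr_sumr; apply: eq_bigr => a; rewrite inE => /andP[_ aM].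
  by case: eqP => // ak; rewrite ak kT in aM.
have kU : k \in free_targets k M by rewrite inE leqnn.
rewrite (bigD1 k) //= eqxx add0r [in RHS](bigD1 k) //=.
have -> : rank (free_targets k M) k = 0%N.
  apply/eqP; rewrite cards_eq0; apply/eqP/setP=> j; rewrite !inE.
  by case: (ltnP j k); rewrite ?andbF.
rewrite expr0 addrAC subrr add0r mulr_sumr; apply: eq_bigr => a /andP[_ ne_a].
by rewrite (negPf ne_a).
Qed.

(** A new point leaves both its arcs open (up step), or closes one of its two
    arcs (level step, with weight yq [h]_q or [h]_q), or closes both (down
    step). *)
Lemma level_sum (k : nat) : (k <= n)%N -> level_sum_spec k.
Proof.
elim: k => [_|k IH lt_kn] h M MR Mm Lh Uh.
  have sweep0 : quadrant 0 0 = sweep 0.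
    by apply/setP=> p; rewrite !inE; case: p.2.2.
  rewrite sweep0 in MR *; rewrite (@sum_sweep n 0 h) //.
  suff -> : negatives M = 0%N by rewrite addn0.
  apply/eqP; rewrite cards_eq0; apply/eqP/setP=> p; rewrite !inE.
  by apply/andP=> -[/(subsetP MR)]; rewrite inE; case: p.2.2.
have {}IH := IH (ltnW lt_kn).
have [i ki] : exists i : 'I_n, k = i by exists (Ordinal lt_kn).
subst k; have kT := notin_targets MR (ltnSn i).
have MR' : M \subset quadrant i.+1 i.
  by apply: subset_trans MR _; apply: quadrant_subset.
rewrite [LHS](target_step MR) (half_level_sum (l := h) IH) //; last first.
  by rewrite free_targets_card ?Uh.
rewrite (eq_bigr (fun b => q ^+ rank (free_sources i.+1 M) b *
   (path_sum i h + y * qint q h * path_sum i h.-1))); last first.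
  move=> b bL; congr (_ * _).
  have bM : b \notin sources M by move: bL; rewrite inE => /andP[].
  have h_gt0 : h = h.-1.+1 by rewrite -Lh (cardsD1 b) bL.
  rewrite (half_level_sum (l := h.-1) IH).
  - by rewrite -h_gt0 targetsU1 setU11 subr0.
  - rewrite subUset sub1set inE /= leqnn /= andbT MR' andbT.
    by move: bL; rewrite inE => /andP[].
  - exact: matchingU1.
  - by move: Lh; rewrite free_sourcesU1 (cardsD1 b) bL => <-.
  - by rewrite free_targetsU1 -free_targetsS -h_gt0.
rewrite -mulr_suml sum_rank Lh kT qintSl /=; ring.
Qed.

Lemma sum_Bset_path_sum :
  \sum_(s in Bset n) (if fixfree s then y ^+ wex s * q ^+ cro_B s else 0)
    * phi (neg s) = path_sum n 0.
Proof.
have free0 (J : {set 'I_n}) :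
    #|[set i : 'I_n | (n <= i)%N && (i \notin J)]| = 0%N.
  by apply: eq_card0 => i; rewrite inE leqNgt ltn_ord.
have quad0 : quadrant n n = set0.
  by apply/setP=> p; rewrite !inE leqNgt ltn_ord.
rewrite -state_sum0 -quad0 (@level_sum n (leqnn n) 0%N) //.
- by rewrite quad0; split=> p o; rewrite inE.
- exact: free0.
- exact: free0.
Qed.

End Weights.

(** * Comparison with the operator D + UDU *)

Section QPolynomial.
Variables (F : fieldType) (q : F).

Definition stepQ (f : {poly F}) : {poly F} :=
  qderiv q f + opU (qderiv q (opU f)).

Lemma qint0 : qint q 0 = 0.
Proof. by rewrite /qint big_ord0. Qed.

Lemma qfactS h : qfact q h.+1 = qfact q h * qint q h.+1.
Proof. by rewrite /qfact big_ord_recr. Qed.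

Lemma coef_opU_qderiv f i : (opU (qderiv q (opU f)))`_i = qint q i * f`_i.-1.
Proof.
rewrite /opU coefXM; case: i => [|i] /=; first by rewrite /qint big_ord0 mul0r.
by rewrite coef_qderiv coefXM.
Qed.

Lemma stepQ_lin a b f g :
  stepQ (a *: f + b *: g) = a *: stepQ f + b *: stepQ g.
Proof.
apply/polyP=> i.
rewrite !(coefD, coefZ, coef_opU_qderiv, coef_qderiv); ring.
Qed.

Lemma iter_stepQ_lin k a b f g : iter k stepQ (a *: f + b *: g)
  = a *: iter k stepQ f + b *: iter k stepQ g.
Proof. by elim: k => // k IH; rewrite !iterS IH stepQ_lin. Qed.

Lemma stepQXn h : stepQ 'X^h = qint q h *: 'X^(h.-1) + qint q h.+1 *: 'X^(h.+1).
Proof. by rewrite /stepQ /opU -exprS !qderivXn /= -scalerAr -exprS. Qed.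

Lemma iter_stepQXn k h : iter k.+1 stepQ 'X^h =
  qint q h *: iter k stepQ 'X^(h.-1) + qint q h.+1 *: iter k stepQ 'X^(h.+1).
Proof. by rewrite iterSr stepQXn iter_stepQ_lin. Qed.

(** When yq = -1 the level steps disappear, and a path with k steps from height
    h to height m has (k + h - m)/2 down steps, where m and k + h have the same
    parity; with the final weight y^(m./2) this gives the power of y in the
    right-hand side for all paths at once.  The factor [h]_q! conjugates the
    step weights of the operator, [h]_q down and [h+1]_q up, into [h]_q^2 and
    1.  The function c keeps or discards a parity class of heights. *)
Lemma path_sum_Qpoly (y : F) (c : bool -> F) (i k h : nat) : 1 + y * q = 0 ->
  path_sum y q (fun m => c (odd m) * y ^+ m./2 * (m == i)%:R) k h =
    c (odd (k + h)) * y ^+ (k + h)./2 * qfact q h * (iter k stepQ 'X^h)`_i.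
Proof.
move=> yq; elim: k h => [|k IH] h /=.
  by rewrite add0n coefXn eq_sym mulrA [qfact q h * _]mulrC.
rewrite yq !IH mul0r mul0r addr0 -iterS iter_stepQXn coefD !coefZ.
case: h => [|h]; rewrite ?addnS ?addSn /=.
  rewrite qint0 qfactS; move: (y ^+ _) (y ^+ _) => a b; ring.
rewrite negbK !qfactS exprS; move: (y ^+ _) => a; ring.
Qed.

End QPolynomial.

(** Taking c = 1 gives the sum over B_n; the indicator of the even parity gives
    the sum over D_n. *)
Lemma sum_Bstar_Qpoly (F : fieldType) (q : F) (n : nat) (c : bool -> F) :
  q != 0 ->
  \sum_(s in Bstar n)
      (c (odd (neg s)) * ((- (1 / q)) ^+ (fwex s)./2 * q ^+ cro_B s))
        *: 'X^(neg s)
    = (c (odd n) * (- (1 / q)) ^+ n./2) *: Qpoly q n.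
Proof.
move=> q0; apply/polyP=> i; rewrite coef_sum coefZ; set y := - (1 / q).
have yq : 1 + y * q = 0 by rewrite /y div1r mulNr mulVf // subrr.
have := path_sum_Qpoly c i n 0 yq; rewrite -sum_Bset_path_sum.
rewrite addn0 /qfact big_ord0 mulr1 /Qpoly => <-.
rewrite [LHS](eq_bigl (fun s => (s \in Bset n) && fixfree s)); last first.
  by move=> s; rewrite inE.
rewrite big_mkcondr; apply: eq_bigr => s _.
case: ifP => _; last by rewrite mul0r.
rewrite coefZ coefXn eq_sym /fwex mul2n halfD odd_double add0n doubleK exprD.
by move: (y ^+ _) (y ^+ _) (q ^+ _) (_%:R) => a b d e; ring.
Qed.

Theorem theorem1p4 (F : fieldType) (q : F) (n : nat)
    (q_neq0 : q != 0) (n_gt0 : (1 <= n)%N) :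
  (\sum_(s in Bstar n)
      ((- (1 / q)) ^+ (fwex s)./2 * q ^+ cro_B s) *: 'X^(neg s)
    = (- (1 / q)) ^+ n./2 *: Qpoly q n)
  /\
  (\sum_(s in Dstar n)
      ((- (1 / q)) ^+ (fwex s)./2 * q ^+ cro_B s) *: 'X^(neg s)
    = if ~~ odd n then (- (1 / q)) ^+ n./2 *: Qpoly q n else 0).
Proof.
split.
  rewrite -[_ ^+ n./2]mul1r -(sum_Bstar_Qpoly n (fun=> 1) q_neq0).
  by apply: eq_bigr => s _; rewrite [1 * (_ * _)]mul1r.
have := sum_Bstar_Qpoly n (fun b => (~~ b)%:R) q_neq0.
have -> : forall z : F, ((~~ odd n)%:R * z) *: Qpoly q n
    = if ~~ odd n then z *: Qpoly q n else 0.
  by move=> z; case: (odd n); rewrite ?mul0r ?mul1r ?scale0r.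
move=> <-.
rewrite (eq_bigl (fun s => (s \in Bstar n) && ~~ odd (neg s))); last first.
  by move=> s; rewrite !inE andbAC.
rewrite big_mkcondr; apply: eq_bigr => s _.
by case: (odd _); rewrite /= ?mul0r ?[1 * (_ * _)]mul1r ?scale0r.
Qed.
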